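(* Let $0\le t\le N-1$, let $\mathbf{R}$ be the collection of critical regions of the certainty equivalence controller $\tilde\pi_t^*$, and let $\mathcal{G}=\mathrm{Aut}(MPC)$. If certainty equivalence holds on a critical region $\mathcal{R}_i\in\mathbf{R}$, i.e. $\pi_t^*(x)=\tilde\pi_t^*(x)$ for all $x\in\mathcal{R}_i$, then certainty equivalence holds on every critical region $\mathcal{R}_j=\Theta\mathcal{R}_i$ in the orbit $\mathcal{G}\mathcal{R}_i=\{\Theta\mathcal{R}_i:(\Theta,\Omega)\in\mathcal{G}\}$, i.e. $\pi_t^*(x)=\tilde\pi_t^*(x)$ for all $x\in\Theta\mathcal{R}_i$ and all $(\Theta,\Omega)\in\mathcal{G}$.
   Context: System: $x_{t+1}=Ax_t+Bu_t+d_t$, with $x_t,d_t\in\mathbb{R}^n$, $u_t\in\mathbb{R}^p$, $A\in\mathbb{R}^{n\times n}$, $B\in\mathbb{R}^{n\times p}$. State constraints $x_t\in\mathcal{X}_t$ and input constraints $u_t\in\mathcal{U}$, where $\mathcal{X}_t\subset\mathbb{R}^n$ and $\mathcal{U}\subset\mathbb{R}^p$ are polytopes (bounded). The disturbances $d_0,d_1,\dots$ are independent random vectors, $d_t$ taking values in a polytope $\mathcal{D}_t\subset\mathbb{R}^n$ and having a probability density function $\mathbf{p}_t$. The horizon $N$ is fixed, and the costs are $f_N(x,u)=f_N(x)=x^TQ_Nx$ and $f_t(x,u)=x^TQ_tx+u^TR_tu$ for $0\le t\le N-1$, with all $Q_t\succ0$, $R_t\succ0$. Exact dynamic program: $J_N^*(x)=f_N(x)$,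 and for $t=N-1,\dots,0$ and $x\in\mathcal{X}_t$, $$J_t(x,u)=f_t(x,u)+E_{d_t}\big(J^*_{t+1}(Ax+Bu+d_t)\big),$$ $$J_t^*(x)=\inf_{u\in\mathcal{U}}J_t(x,u)\ \text{ subject to } Ax+Bu+d\in\mathcal{X}_{t+1}\ \forall d\in\mathcal{D}_t,$$ with optimizer $\pi_t^*(x)$. Certainty equivalence dynamic program: $\tilde J_N^*(x)=f_N(x)$, and for $t=N-1,\dots,0$ and $x\in\mathcal{X}_t$, $$\tilde J_t(x,u)=f_t(x,u)+\tilde J^*_{t+1}(Ax+Bu+E(d_t)),$$ $$\tilde J_t^*(x)=\inf_{u\in\mathcal{U}}\tilde J_t(x,u)\ \text{ subject to } Ax+Bu+d\in\mathcal{X}_{t+1}\ \forall d\in\mathcal{D}_t,$$ with optimizer $\tilde\pi_t^*(x)$. Convention: the infimum of an infeasible problem is $+\infty$, and $\pi_t^*(x)$ (resp. $\tilde\pi_t^*(x)$) is defined at those $x\in\mathcal{X}_t$ with $J_t^*(x)<\infty$ (resp. $\tilde J_t^*(x)<\infty$). The equality $\pi_t^*(x)=\tilde\pi_t^*(x)$ includes the assertion that both sides are defined. The function $\tilde\pi_t^*$ is piecewise affine on polyhedra; its critical regions are the polyhedral regions of the partition of its domain (obtained by solving the certainty equivalence problem as a multiparametric program), on each of which $\tilde\pi_t^*$ is given by a single affine law. $\mathrm{Aut}(MPC)$ is the group of symmetries: pairs of invertible matrices $(\Theta,\Omega)$, $\Theta\in\mathbb{R}^{n\times n}$, $\Omega\in\mathbb{R}^{p\times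 p}$, such that $\Theta A=A\Theta$, $\Theta B=B\Omega$, and for all relevant $t$ in $0,\dots,N$: $f_t(\Theta x,\Omega u)=f_t(x,u)$ for all $x,u$; $\Theta\mathcal{X}_t=\mathcal{X}_t$; $\Omega\,\mathcal{U}=\mathcal{U}$; $\Theta\mathcal{D}_t=\mathcal{D}_t$; and $\mathbf{p}_t(\Theta d)=\mathbf{p}_t(d)$ for all $d\in\mathcal{D}_t$. *)

(* Defs.v *)
From HB Require Import structures.
From mathcomp Require Import all_boot all_order all_algebra.
From mathcomp Require Import all_classical all_reals all_analysis.

Set Implicit Arguments.
Unset Strict Implicit.
Unset Printing Implicit Defensive.

Import Order.TTheory GRing.Theory Num.Theory.
Import numFieldNormedType.Exports.

Local Open Scope classical_set_scope.
Local Open Scope ring_scope.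

(* ** The measurable space R^n, seen as column vectors.

   The sigma-algebra is the one generated by the coordinates (the same
   construction as the library's for [n.-tuple R]); it is the Borel
   sigma-algebra of R^n. *)

Definition measure_cV_display : measure_display. Proof. exact. Qed.

Section measurable_cV.
Variables (R : realType) (n : nat).

Definition cV_coord (i : 'I_n) (x : 'cV[R]_n) : measurableTypeR R := x i 0.

Let cV_set0 : g_sigma_preimage cV_coord set0.
Proof. exact: sigma_algebra0. Qed.

Let cV_setC S : g_sigma_preimage cV_coord S -> g_sigma_preimage cV_coord (~` S).
Proof. exact: sigma_algebraC. Qed.

Let cV_bigcup (F : _^nat) : (forall i, g_sigma_preimage cV_coord (F i)) ->
  g_sigma_preimage cV_coord (\bigcup_i (F i)).
Proof. exact: sigma_algebra_bigcup. Qed.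

HB.instance Definition _ := @isMeasurable.Build measure_cV_display
  'cV[R]_n (g_sigma_preimage cV_coord) cV_set0 cV_setC cV_bigcup.

Lemma measurable_cV_coord (i : 'I_n) : measurable_fun setT (cV_coord i).
Proof.
move=> _ Y mY; rewrite setTI; apply: sub_sigma_algebra => /=.
rewrite -bigcup_seq/=; exists i => /=; first by rewrite mem_index_enum.
by exists Y => //; rewrite setTI.
Qed.

Lemma measurable_fun_cVP d (T : measurableType d) (f : T -> 'cV[R]_n) :
  (forall i, measurable_fun setT (cV_coord i \o f)) -> measurable_fun setT f.
Proof.
move=> mf _ S mS; rewrite setTI.
have : preimage_set_system setT f (g_sigma_preimage cV_coord) (f @^-1` S).
  by exists S => //; rewrite setTI.
rewrite -g_sigma_preimage_comp; apply: smallest_sub.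
  exact: sigma_algebra_measurable.
rewrite -bigcup_seq; apply: bigcup_sub => i _ _ [B mB <-].
exact: mf.
Qed.

End measurable_cV.

(* ** Lebesgue measure on R^n, as the iterated product of the Lebesgue measure
   of R. *)

Section lebesgue_cV_step.
Variables (R : realType) (n : nat).
Variable m : {sigma_finite_measure set 'cV[R]_n -> \bar R}.

Definition cV_cons (z : measurableTypeR R * 'cV[R]_n) : 'cV[R]_n.+1 :=
  col_mx (z.1)%:M z.2.

Definition cV_uncons (x : 'cV[R]_n.+1) : measurableTypeR R * 'cV[R]_n :=
  (cV_coord 0 x, dsubmx (x : 'cV[R]_(1 + n))).

Lemma cV_cons0 z : cV_cons z ord0 0 = z.1.
Proof.
rewrite /cV_cons (_ : ord0 = lshift n (0 : 'I_1) :> 'I_n.+1); last exact/val_inj.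
by rewrite [LHS](@col_mxEu _ 1 n 1) mxE eqxx mulr1n.
Qed.

Lemma cV_consS z i : cV_cons z (lift ord0 i) 0 = z.2 i 0.
Proof.
rewrite /cV_cons (_ : lift ord0 i = rshift 1 i :> 'I_n.+1); last exact/val_inj.
by rewrite [LHS](@col_mxEd _ 1 n 1).
Qed.

Lemma cV_consK : cancel cV_cons cV_uncons.
Proof.
move=> [a y]; rewrite /cV_uncons /cV_coord; congr (_, _); first exact: cV_cons0.
exact: col_mxKd.
Qed.

Lemma cV_unconsK : cancel cV_uncons cV_cons.
Proof.
move=> x; apply/matrixP => i j; rewrite ord1.
case: (unliftP ord0 i) => [k ->|->]; last exact: cV_cons0.
rewrite cV_consS /= mxE; congr (x _ _); exact/val_inj.
Qed.

Lemma measurable_cV_cons : measurable_fun setT cV_cons.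
Proof.
apply: measurable_fun_cVP => i; case: (unliftP ord0 i) => [j ->|->].
  rewrite (_ : _ \o _ = cV_coord j \o snd).
    by apply: measurableT_comp; [exact: measurable_cV_coord|].
  by apply/funext => z; exact: cV_consS.
rewrite (_ : _ \o _ = fst); first exact: measurable_fst.
by apply/funext => z; exact: cV_cons0.
Qed.

Lemma measurable_cV_uncons : measurable_fun setT cV_uncons.
Proof.
apply: measurable_fun_pair; first exact: measurable_cV_coord.
apply: measurable_fun_cVP => i.
rewrite (_ : _ \o _ = cV_coord (rshift 1 i)); first exact: measurable_cV_coord.
by apply/funext => x; rewrite /cV_coord /= mxE.
Qed.

HB.instance Definition _ :=
  @isMeasurableFun.Build _ _ _ _ cV_cons measurable_cV_cons.

Definition lebesgue_cV_cons : set 'cV[R]_n.+1 -> \bar R :=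
  pushforward (lebesgue_measure \x m)%E cV_cons.

Let lebesgue_cV_cons0 : lebesgue_cV_cons set0 = 0%E.
Proof. exact: measure0. Qed.

Let lebesgue_cV_cons_ge0 S : (0 <= lebesgue_cV_cons S)%E.
Proof. exact: measure_ge0. Qed.

Let lebesgue_cV_cons_sigma_additive : semi_sigma_additive lebesgue_cV_cons.
Proof. exact: measure_semi_sigma_additive. Qed.

HB.instance Definition _ := isMeasure.Build _ _ _ lebesgue_cV_cons
  lebesgue_cV_cons0 lebesgue_cV_cons_ge0 lebesgue_cV_cons_sigma_additive.

Let lebesgue_cV_cons_sigma_finite : sigma_finite setT lebesgue_cV_cons.
Proof.
have /sigma_finiteP[F [FT ndF Foo]] := sigma_finiteT (@lebesgue_measure R).
have /sigma_finiteP[G [GT ndG Goo]] := sigma_finiteT m.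
exists (fun k => cV_uncons @^-1` (F k `*` G k)).
  rewrite -preimage_bigcup (_ : \bigcup_k _ = setT) ?preimage_setT//.
  apply/seteqP; split => // -[a y] _.
  have [k _ Fka] : (\bigcup_k F k) a by rewrite -FT.
  have [l _ Gly] : (\bigcup_k G k) y by rewrite -GT.
  exists (maxn k l) => //; split => /=.
  - by move: a Fka; exact/subsetPset/ndF/leq_maxl.
  - by move: y Gly; exact/subsetPset/ndG/leq_maxr.
move=> k; have [mF Fkoo] := Foo k; have [mG Gkoo] := Goo k.
have mFG : measurable (F k `*` G k) by exact: measurableX.
split.
  by rewrite -[X in measurable X]setTI; exact: measurable_cV_uncons.
rewrite /lebesgue_cV_cons /pushforward -comp_preimage.
rewrite (_ : cV_uncons \o cV_cons = id); last first.
  by apply/funext => z /=; rewrite cV_consK.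
by rewrite preimage_id product_measure1E// lte_mul_pinfty// ge0_fin_numE.
Qed.

HB.instance Definition _ :=
  Measure_isSigmaFinite.Build _ _ _ lebesgue_cV_cons
    lebesgue_cV_cons_sigma_finite.

End lebesgue_cV_step.

Fixpoint lebesgue_cV (R : realType) (n : nat) :
    {sigma_finite_measure set 'cV[R]_n -> \bar R} :=
  match n with
  | 0 => \d_(0 : 'cV[R]_0)
  | n'.+1 => lebesgue_cV_cons (lebesgue_cV R n')
  end.

Lemma lebesgue_cV_box (R : realType) n (S : 'I_n -> set R) :
  (forall i, measurable (S i : set (measurableTypeR R))) ->
  lebesgue_cV R n [set x : 'cV[R]_n | forall i, S i (x i 0)]
  = (\prod_(i < n) lebesgue_measure (S i))%E.
Proof.
elim: n S => [|n IH] S mS.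
  by rewrite big_ord0 /= diracE mem_set// => -[].
rewrite big_ord_recl -IH // /= /lebesgue_cV_cons /pushforward.
set box := [set x : 'cV[R]_n | _].
have -> : cV_cons (R:=R) (n:=n) @^-1` [set x : 'cV[R]_n.+1 | forall i, S i (x i 0)]
    = S ord0 `*` box.
  apply/seteqP; split => [z/= Sz|z/= [S0z Sz] i].
    split=> [|i]; first by have := Sz ord0; rewrite cV_cons0.
    by have := Sz (lift ord0 i); rewrite cV_consS.
  by case: (unliftP ord0 i) => [j ->|->]; rewrite ?cV_consS ?cV_cons0//; exact: Sz.
rewrite product_measure1E//.
have -> : box = \bigcap_(i in [set: 'I_n]) (cV_coord i @^-1` S (lift ord0 i)).
  by apply/seteqP; split => x /= h i; [move=> _|]; apply: h.
apply: fin_bigcap_measurable => // i _.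
by rewrite -[X in measurable X]setTI; apply: measurable_cV_coord.
Qed.

(* ** Random vectors *)

Section random_vectors.
Context d (T : measurableType d) (R : realType) (P : probability T R).

Definition mutually_independent n (X : nat -> {RV P >-> 'cV[R]_n}) : Prop :=
  forall (s : seq nat) (E : nat -> set 'cV[R]_n), uniq s ->
    (forall i, measurable (E i)) ->
    P (\bigcap_(i in [set` s]) (X i @^-1` E i))
    = (\prod_(i <- s) P (X i @^-1` E i))%E.

Definition has_density n (X : {RV P >-> 'cV[R]_n}) (f : 'cV[R]_n -> R) : Prop :=
  [/\ measurable_fun setT (f : 'cV[R]_n -> measurableTypeR R),
      (forall x, 0 <= f x) &
      forall S : set 'cV[R]_n, measurable S ->
        distribution P X S = (\int[lebesgue_cV R n]_(x in S) (f x)%:E)%E].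

Definition mean n (X : {RV P >-> 'cV[R]_n}) : 'cV[R]_n :=
  \col_i fine ('E_P[(fun w => X w i 0)%R])%E.

End random_vectors.

(* ** Polyhedra and quadratic forms *)

Section convex_data.
Variable R : realType.

Definition polyhedron n (S : set 'cV[R]_n) : Prop :=
  exists (m : nat) (H : 'M[R]_(m, n)) (h : 'cV[R]_m),
    S = [set x | forall i, (H *m x) i 0 <= h i 0].

Definition polytope n (S : set 'cV[R]_n) : Prop :=
  polyhedron S /\ bounded_set S.

Definition quad n (Q : 'M[R]_n) (x : 'cV[R]_n) : R := (x^T *m Q *m x) 0 0.

Definition posdef n (Q : 'M[R]_n) : Prop :=
  Q^T = Q /\ forall x : 'cV[R]_n, x != 0 -> 0 < quad Q x.

End convex_data.

(* ** The control problem *)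

Record mpc (R : realType) (n p : nat) := Mpc {
  horizon : nat;
  dynA : 'M[R]_n;
  dynB : 'M[R]_(n, p);
  stateset : nat -> set 'cV[R]_n;
  inputset : set 'cV[R]_p;
  distset : nat -> set 'cV[R]_n;
  density : nat -> 'cV[R]_n -> R;
  costQ : nat -> 'M[R]_n;
  costR : nat -> 'M[R]_p
}.

Section mpc.
Variables (R : realType) (n p : nat) (M : mpc R n p).

Local Notation N := (horizon M).

Definition cost (t : nat) (x : 'cV[R]_n) (u : 'cV[R]_p) : R :=
  if (t < N)%N then quad (costQ M t) x + quad (costR M t) u
  else quad (costQ M t) x.

Definition feasible (t : nat) (x : 'cV[R]_n) (u : 'cV[R]_p) : Prop :=
  inputset M u /\
  forall e, distset M t e -> stateset M t.+1 (dynA M *m x + dynB M *m u + e).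

(* The two dynamic programs differ only in the way the cost-to-go [V] at time
   [t.+1] is averaged over the successors [z + d_t] of the nominal successor
   [z = A x + B u]; [next t V z] is that average. Value functions take values
   in the extended reals, so that the infimum of an infeasible problem is +oo.
   They are computed by the same formula outside the state constraints: these
   values are never used, since feasibility keeps all successors in the state
   constraints, and [domain] below restricts the optimizer to them. *)
Section dynamic_program.
Variable next : nat -> ('cV[R]_n -> \bar R) -> 'cV[R]_n -> \bar R.

Definition bellman_objective t (V : 'cV[R]_n -> \bar R) x u : \bar R :=
  ((cost t x u)%:E + next t V (dynA M *m x + dynB M *m u))%E.

Fixpoint value_togo (k : nat) : 'cV[R]_n -> \bar R :=
  match k with
  | 0 => fun x => (cost N x 0)%:E
  | k'.+1 => fun x => ereal_inf
      [set bellman_objective (N - k'.+1) (value_togo k') x u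
       | u in feasible (N - k'.+1) x]
  end.

Definition value (t : nat) : 'cV[R]_n -> \bar R := value_togo (N - t).

Definition objective (t : nat) : 'cV[R]_n -> 'cV[R]_p -> \bar R :=
  bellman_objective t (value t.+1).

Lemma value_terminal x : value N x = (quad (costQ M N) x)%:E.
Proof. by rewrite /value subnn /= /cost ltnn. Qed.

Lemma value_bellman t x : (t < N)%N ->
  value t x = ereal_inf [set objective t x u | u in feasible t x].
Proof.
move=> tN; rewrite /objective /value -(subnSK tN) /=.
by rewrite (subnSK tN) (subKn (ltnW tN)).
Qed.

Definition domain (t : nat) : set 'cV[R]_n :=
  [set x | stateset M t x /\ (value t x < +oo)%E].

Definition minimizer (t : nat) (x : 'cV[R]_n) (u : 'cV[R]_p) : Prop :=
  feasible t x u /\ objective t x u = value t x.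

(* The optimizer, as a definite description; 0 is a dummy value. On the domain
   the input set is compact and the objective is lower semicontinuous and
   strictly convex in [u], so that the minimizer exists and is unique. *)
Definition optimizer (t : nat) (x : 'cV[R]_n) : 'cV[R]_p :=
  xget 0 [set u | minimizer t x u /\ forall v, minimizer t x v -> v = u].

End dynamic_program.

(* Costs and state constraints are relevant up to the terminal time [N], the
   disturbance data only at the times [t < N] at which they enter the dynamic
   programs. *)
Definition mpc_aut : set ('M[R]_n * 'M[R]_p) :=
  [set g | let: (Th, Om) := g in
    [/\ Th \in unitmx, Om \in unitmx,
        Th *m dynA M = dynA M *m Th & Th *m dynB M = dynB M *m Om] /\
    [/\ forall t, (t <= N)%N -> forall x u,
          cost t (Th *m x) (Om *m u) = cost t x u,
        forall t, (t <= N)%N ->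
          [set Th *m x | x in stateset M t] = stateset M t,
        [set Om *m u | u in inputset M] = inputset M,
        forall t, (t < N)%N -> [set Th *m e | e in distset M t] = distset M t &
        forall t, (t < N)%N -> forall e, distset M t e ->
          density M t (Th *m e) = density M t e]].

Definition region_orbit (S : set 'cV[R]_n) : set (set 'cV[R]_n) :=
  [set [set g.1 *m x | x in S] | g in mpc_aut].

(* [Rs] is a polyhedral partition of [D] (closed pieces, which may overlap on
   their boundaries only) with a single affine law for [pi] on each piece. *)
Definition critical_regions (D : set 'cV[R]_n) (pi : 'cV[R]_n -> 'cV[R]_p)
    (Rs : set (set 'cV[R]_n)) : Prop :=
  [/\ finite_set Rs,
      \bigcup_(S in Rs) S = D,
      forall S, Rs S -> [/\ polyhedron S, S !=set0 &
        exists (F : 'M[R]_(p, n)) (g : 'cV[R]_p),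
          forall x, S x -> pi x = F *m x + g] &
      forall S S', Rs S -> Rs S' -> S <> S' -> S° `&` S'° = set0].

End mpc.

(* ** Disturbances, exact and certainty equivalence programs *)

Section stochastic_mpc.
Context d (T : measurableType d) (R : realType) (P : probability T R).
Variables (n p : nat) (M : mpc R n p).
Variable dist : nat -> {RV P >-> 'cV[R]_n}.

Local Notation N := (horizon M).

Record mpc_assumptions : Prop := MpcAssumptions {
  stateset_polytope : forall t, (t <= N)%N -> polytope (stateset M t);
  inputset_polytope : polytope (inputset M);
  distset_polytope : forall t, polytope (distset M t);
  dist_independent : mutually_independent dist;
  dist_in_distset : forall t w, distset M t (dist t w);
  dist_density : forall t, has_density (dist t) (density M t);
  costQ_posdef : forall t, (t <= N)%N -> posdef (costQ M t);
  costR_posdef : forall t, (t < N)%N -> posdef (costR M t)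
}.

(* Expectation over the law of [d_t]. *)
Definition exact_next t (V : 'cV[R]_n -> \bar R) (z : 'cV[R]_n) : \bar R :=
  (\int[distribution P (dist t)]_e V (z + e)%R)%E.

Definition ce_next t (V : 'cV[R]_n -> \bar R) (z : 'cV[R]_n) : \bar R :=
  V (z + mean (dist t)).

Definition exact_policy : nat -> 'cV[R]_n -> 'cV[R]_p :=
  optimizer M exact_next.

Definition ce_policy : nat -> 'cV[R]_n -> 'cV[R]_p :=
  optimizer M ce_next.

Definition certainty_equivalence_on (t : nat) (S : set 'cV[R]_n) : Prop :=
  forall x, S x -> [/\ domain M exact_next t x, domain M ce_next t x &
                       exact_policy t x = ce_policy t x].

End stochastic_mpc.

(* Main.v *)
Require Import Defs.
From HB Require Import structures.
From mathcomp Require Import all_boot all_order all_algebra.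
From mathcomp Require Import all_classical all_reals all_analysis.
From mathcomp Require Import measurable_realfun.
From mathcomp Require Import ring lra.

(** A symmetry [(Th, Om)] maps one instance of either Bellman recursion at [x]
    to the instance at [Th *m x]: feasibility and stage costs are carried over
    by the definition of a symmetry, so the value functions are
    [Th]-invariant, and the optimizers [Th]-equivariant, as soon as averaging
    the cost-to-go over the disturbance commutes with [Th] ([value_togo_aut],
    [optimizer_aut]).  Both the exact and the certainty equivalence policy
    therefore satisfy [pi (Th *m x) = Om *m pi x], and their equality at [x]
    is transported to [Th *m x].  The argument is pointwise in [x].

    What has to be shown is that the two averaging operators respect [Th].
    Both follow from the invariance of the law of the disturbance under [Th]
    ([distribution_invariant]): directly for the expectation
    ([integral_law_invariant]), and by fixing the mean for certainty
    equivalence ([mean_invariant]).  The density is invariant on the support,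
    so the law is invariant once Lebesgue measure is.  The terminal cost gives
    this: [Th] preserves a positive definite quadratic form, hence its unit
    ball [E], which is symmetric and has positive finite measure.  By Tonelli
    and translation invariance, a linear automorphism preserving such an [E]
    preserves the measure of every set ([lebesgue_cV_linear]); this is the
    uniqueness argument for Haar measure.

    The change of variables under a measure-preserving bijection is proved for
    arbitrary integrands ([integral_comp_preserving]), which spares a proof
    that the cost-to-go of the exact program is measurable. *)

Set Implicit Arguments.
Unset Strict Implicit.
Unset Printing Implicit Defensive.

Import Order.TTheory GRing.Theory Num.Theory.
Import numFieldNormedType.Exports.

Local Open Scope classical_set_scope.
Local Open Scope ring_scope.

(** * Change of variables for arbitrary integrands *)

Section measure_preserving_integral.
Context d (T : measurableType d) (R : realType).
Variable mu : {measure set T -> \bar R}.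
Import HBNNSimple.

(** A named composite, so that the simple-function structure below has a key of
    its own instead of competing with those attached to [\o]. *)
Definition nnsfun_comp (phi : {mfun T >-> T}) (h : {nnsfun T >-> R}) : T -> R :=
  fun x => h (phi x).

Section nnsfun_comp.
Variables (phi : {mfun T >-> T}) (h : {nnsfun T >-> R}).

Let measurable_nnsfun_comp : measurable_fun [set: T] (nnsfun_comp phi h).
Proof. exact: measurableT_comp. Qed.

Let finite_nnsfun_comp : finite_set (range (nnsfun_comp phi h)).
Proof.
apply: (@sub_finite_set _ _ (range h)); last exact: fimfunP.
by move=> _ [x _ <-]; exists (phi x).
Qed.

Let nnsfun_comp_ge0 x : 0 <= nnsfun_comp phi h x.
Proof. exact: fun_ge0. Qed.

HB.instance Definition _ :=
  @isMeasurableFun.Build _ _ _ _ (nnsfun_comp phi h) measurable_nnsfun_comp.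
HB.instance Definition _ :=
  @FiniteImage.Build _ _ (nnsfun_comp phi h) finite_nnsfun_comp.
HB.instance Definition _ :=
  @isNonNegFun.Build _ _ (nnsfun_comp phi h) nnsfun_comp_ge0.

End nnsfun_comp.

Variables phi psi : {mfun T >-> T}.
Hypotheses (phiK : cancel phi psi) (psiK : cancel psi phi).
Hypothesis phi_mu : forall A, measurable A -> mu (phi @^-1` A) = mu A.

Let simple_below (f : T -> \bar R) :=
  [set h : {nnsfun T >-> R} | forall x, ((h x)%:E <= f x)%E].

Let sup_simple_le (theta : {mfun T >-> T}) (f : T -> \bar R) :
  (forall A, measurable A -> mu (theta @^-1` A) = mu A) ->
  (ereal_sup [set sintegral mu h | h in simple_below f] <=
   ereal_sup [set sintegral mu h | h in simple_below (f \o theta)])%E.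
Proof.
move=> theta_mu; apply: ge_ereal_sup => _ [h hf <-].
apply: ereal_sup_ubound; exists (nnsfun_comp theta h : {nnsfun T >-> R}) => [x|].
  exact: hf.
rewrite /sintegral; apply: eq_fsbigr => r _; congr (_ * _)%E.
rewrite -[RHS]theta_mu//.
Qed.

Let sup_simple_comp (f : T -> \bar R) :
  ereal_sup [set sintegral mu h | h in simple_below (f \o phi)] =
  ereal_sup [set sintegral mu h | h in simple_below f].
Proof.
have psi_mu A : measurable A -> mu (psi @^-1` A) = mu A.
  move=> mA; rewrite -phi_mu; last by rewrite -[X in measurable X]setTI; exact: measurable_funPT.
  by congr (mu _); apply/seteqP; split=> x /=; rewrite phiK.
apply/eqP; rewrite eq_le sup_simple_le// andbT.
have := sup_simple_le (f \o phi) psi_mu.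
suff -> : (f \o phi) \o psi = f by [].
by apply/funext => x /=; rewrite psiK.
Qed.

(** Stated for every [f], measurable or not, so that it applies to a cost-to-go
    function.  The integral of a nonnegative function is the supremum of the integrals of the simple functions below it, and
    composition with [phi] and with its inverse [psi] exchanges the simple
    functions below [f] and those below [f \o phi], keeping their integrals. *)
Lemma integral_comp_preserving (D : set T) (f : T -> \bar R) :
  (\int[mu]_(x in phi @^-1` D) f (phi x) = \int[mu]_(x in D) f x)%E.
Proof.
rewrite /integral.
have -> : (fun x => f (phi x)) \_ (phi @^-1` D) = (f \_ D) \o phi.
  by apply/funext => x; rewrite /patch /=; congr (if _ then _ else _); apply/idP/idP; rewrite !inE.
rewrite funepos_comp funeneg_comp (sup_simple_comp (f \_ D)^\+%E) (sup_simple_comp (f \_ D)^\-%E).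
reflexivity.
Qed.

End measure_preserving_integral.

(** * Measurability in R^n *)

Lemma measurable_funT_preimage d1 d2 (T1 : measurableType d1)
    (T2 : measurableType d2) (f : T1 -> T2) (A : set T2) :
  measurable_fun setT f -> measurable A -> measurable (f @^-1` A).
Proof. by move=> mf mA; rewrite -[X in measurable X]setTI; exact: mf. Qed.

Lemma measurable_cV_linear d (T : measurableType d) (R : realType) m n
    (F : 'M[R]_(m, n)) (f : T -> 'cV[R]_n) :
  measurable_fun setT f -> measurable_fun setT (fun x => F *m f x).
Proof.
move=> mf; apply: measurable_fun_cVP => i.
rewrite (_ : _ \o _ = (fun x => \sum_j F i j * f x j 0)); last first.
  by apply/funext => x; rewrite /cV_coord /= mxE.
apply: measurable_sum => j; apply: measurable_funM => //.
exact: (measurableT_comp (measurable_cV_coord j)).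
Qed.

Lemma measurable_cVD d (T : measurableType d) (R : realType) n
    (f g : T -> 'cV[R]_n) :
  measurable_fun setT f -> measurable_fun setT g ->
  measurable_fun setT (fun x => f x + g x).
Proof.
move=> mf mg; apply: measurable_fun_cVP => i.
rewrite (_ : _ \o _ = (fun x => f x i 0 + g x i 0)); last first.
  by apply/funext => x; rewrite /cV_coord /= mxE.
by apply: measurable_funD; apply: (measurableT_comp (measurable_cV_coord i)).
Qed.

Lemma measurable_polyhedron (R : realType) m (S : set 'cV[R]_m) : polyhedron S -> measurable S.
Proof.
move=> [k [H [h ->]]].
rewrite (_ : [set x | _] = \bigcap_(i in [set: 'I_k])
  ((fun x => cV_coord i (H *m x)) @^-1` `]-oo, h i 0]%classic)); last first.
  apply/seteqP; split=> x /= Hx i; first by move=> _; rewrite /= in_itv/=; exact: Hx.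
  by have := Hx i Logic.I; rewrite /= in_itv.
apply: fin_bigcap_measurable => // i _.
apply: measurable_funT_preimage; last exact: measurable_itv.
apply: (measurableT_comp (measurable_cV_coord i)).
exact: measurable_cV_linear.
Qed.

(** * Translation invariance of Lebesgue measure *)

Section lebesgue_translation.
Variable R : realType.

Lemma lebesgue_measure_translation (a : R) (A : set R) :
  measurable (A : set (measurableTypeR R)) ->
  lebesgue_measure ((fun x => x + a) @^-1` A) = lebesgue_measure A.
Proof.
move=> mA.
have ma : measurable_fun [set: measurableTypeR R] (fun x : measurableTypeR R => x + a : measurableTypeR R).
  exact: measurable_funD.
pose tr := MeasurableFun.Pack (MeasurableFun.Class (isMeasurableFun.Build _ _ _ _ _ ma)).
apply/esym/(@lebesgue_measure_unique _ (pushforward lebesgue_measure tr)) => // _ [[b c] _ <-].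
rewrite /pushforward.
rewrite [X in _ = lebesgue_measure X](_ : _ = `](b - a), (c - a)]%classic); last first.
  by apply/seteqP; split=> x /=; rewrite !in_itv/= ltrBlDr lerBrDr.
rewrite !lebesgue_measure_itv/= !lte_fin ltrD2r.
by case: ifP => // _; rewrite -!EFinB; congr (_%:E); rewrite opprB addrA subrK.
Qed.

(** By induction on the dimension: the translate of the product measure agrees
    with the product measure on rectangles, hence everywhere. *)
Lemma lebesgue_cV_translation n (v : 'cV[R]_n) (A : set 'cV[R]_n) :
  measurable A ->
  lebesgue_cV R n ((fun x => x + v) @^-1` A) = lebesgue_cV R n A.
Proof.
elim: n v A => [|n IH] v A mA.
  rewrite /= (_ : (fun x => x + v) @^-1` A = A)//.
  by apply/seteqP; split=> x; rewrite /= !flatmx0 ?(flatmx0 (x + v)).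
pose a := (cV_uncons v).1; pose w := (cV_uncons v).2.
pose tau (z : measurableTypeR R * 'cV[R]_n) : measurableTypeR R * 'cV[R]_n := (z.1 + a, z.2 + w).
have mtau : measurable_fun setT tau.
  apply: measurable_fun_pair.
    by apply: measurable_funD.
  exact: measurable_cVD.
pose tr := MeasurableFun.Pack (MeasurableFun.Class (isMeasurableFun.Build _ _ _ _ _ mtau)).
have mB : measurable ((@cV_cons R n) @^-1` A).
  exact: measurable_funT_preimage (@measurable_cV_cons _ _) mA.
rewrite /= /lebesgue_cV_cons /pushforward.
transitivity (pushforward (lebesgue_measure \x lebesgue_cV R n)%E tr ((@cV_cons R n) @^-1` A)).
  rewrite /pushforward; congr (_ _); apply/seteqP.
  have E z : cV_cons z + v = cV_cons (tau z).
    apply/matrixP => i j; rewrite ord1 mxE; case: (unliftP ord0 i) => [k ->|->].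
      by rewrite !cV_consS !mxE; congr (_ + v _ _); exact/val_inj.
    by rewrite !cV_cons0.
  by split=> z /=; rewrite E.
apply/esym/product_measure_unique => // B C mB' mC.
rewrite [LHS](_ : _ = (lebesgue_measure \x lebesgue_cV R n)%E
  (((fun x => x + a) @^-1` B) `*` ((fun y => y + w) @^-1` C)))//.
have mtB : measurable ((fun x => x + a) @^-1` B : set (measurableTypeR R)).
  apply: (measurable_funT_preimage _ mB').
  exact: (@measurable_funD _ (measurableTypeR R) R setT id (cst a)).
have mtC : measurable ((fun y => y + w) @^-1` C).
  apply: (measurable_funT_preimage _ mC); exact: measurable_cVD.
rewrite product_measure1E//; congr (_ * _)%E; last exact: IH.
exact: lebesgue_measure_translation.
Qed.

End lebesgue_translation.

(** * Quadratic forms *)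

Section quadratic_form.
Variable R : realType.

Lemma quad_expand n (Q : 'M[R]_n) (x : 'cV[R]_n) :
  quad Q x = \sum_i \sum_j x i 0 * Q i j * x j 0.
Proof.
rewrite /quad mxE exchange_big /=; apply: eq_bigr => j _.
rewrite mxE big_distrl /=; apply: eq_bigr => i _; by rewrite mxE.
Qed.

Lemma quadZ n (Q : 'M[R]_n) a (x : 'cV[R]_n) : quad Q (a *: x) = a ^+ 2 * quad Q x.
Proof. by rewrite /quad [(a *: x)^T]linearZ /= -!scalemxAl -scalemxAr scalerA mxE expr2. Qed.

Lemma quadN n (Q : 'M[R]_n) (x : 'cV[R]_n) : quad Q (- x) = quad Q x.
Proof. by rewrite -scaleN1r quadZ sqrrN expr1n mul1r. Qed.

Lemma quadD n (Q : 'M[R]_n) (x y : 'cV[R]_n) : Q^T = Q ->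
  quad Q (x + y) = quad Q x + 2 * (x^T *m Q *m y) 0 0 + quad Q y.
Proof.
move=> Qsym; have yx : (y^T *m Q *m x) 0 0 = (x^T *m Q *m y) 0 0.
  by rewrite -[in RHS](trmxK (x^T *m Q *m y)) [RHS]mxE !trmx_mul trmxK Qsym mulmxA.
rewrite /quad [(x + y)^T]linearD /= !mulmxDl !mulmxDr.
have mxD (A B : 'M[R]_1) : (A + B) 0 0 = A 0 0 + B 0 0 by rewrite mxE.
by rewrite !mxD yx; ring.
Qed.

(** The Cauchy-Schwarz inequality for the scalar product of [Q]: the coordinate
    [x i 0] is the [Q]-product of [x] with [invmx Q *m delta_mx i 0]. *)
Lemma quad_coord_bound n (Q : 'M[R]_n) : posdef Q -> exists2 c : R, 0 < c &
  forall (x : 'cV[R]_n) i, `|x i 0| ^+ 2 <= c * quad Q x.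
Proof.
move=> [Qsym Qpos].
have quad_ge0 x : 0 <= quad Q x.
  have [->|/Qpos/ltW//] := eqVneq x 0.
  by rewrite /quad trmx0 !mul0mx mxE.
have Qunit : Q \in unitmx.
  rewrite -row_free_unit -kermx_eq0; apply/eqP/row_matrixP => i; rewrite row0.
  set v := row i _.
  have vQ : v *m Q = 0 by rewrite /v -row_mul mulmx_ker row0.
  apply/eqP; apply: contraT => v0; have := Qpos v^T.
  by rewrite -(inj_eq trmx_inj) trmxK trmx0 v0 /quad trmxK vQ mul0mx mxE ltxx => /(_ isT).
pose y i : 'cV[R]_n := invmx Q *m delta_mx i 0.
have cs (x : 'cV[R]_n) i : `|x i 0| ^+ 2 <= quad Q (y i) * quad Q x.
  have [->|x0] := eqVneq x 0.
    by rewrite mxE normr0 expr0n /= mulr_ge0.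
  have yQx : (x^T *m Q *m y i) 0 0 = x i 0.
    by rewrite /y -mulmxA mulKVmx// -colE !mxE.
  have qx := Qpos _ x0.
  (* The component of y i that is Q-orthogonal to x, times quad Q x. *)
  have := quad_ge0 (quad Q x *: y i - x i 0 *: x).
  rewrite addrC -scaleNr quadD// !quadZ [(_ *: x)^T]linearZ /= -!scalemxAl -scalemxAr.
  rewrite scalerA [(_ *: (x^T *m _ *m _)) 0 0]mxE yQx.
  rewrite (_ : _ + _ = quad Q x * (quad Q (y i) * quad Q x - x i 0 ^+ 2)).
    by rewrite pmulr_rge0// subr_ge0 real_normK ?num_real.
  by ring.
pose c := 1 + \sum_i quad Q (y i).
exists c.
  by rewrite ltr_wpDr// sumr_ge0.
move=> x i; apply: (le_trans (cs x i)); apply: ler_wpM2r => //.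
rewrite /c (bigD1 i)//= addrCA lerDl addr_ge0// sumr_ge0//.
Qed.

Lemma quad_le n (Q : 'M[R]_n) : exists2 c : R, 0 < c &
  forall (x : 'cV[R]_n) (r : R), 0 <= r -> (forall i, `|x i 0| <= r) -> quad Q x <= c * r ^+ 2.
Proof.
exists (1 + \sum_i \sum_j `|Q i j|).
  by rewrite ltr_wpDr// sumr_ge0// => i _; rewrite sumr_ge0.
move=> x r r0 xr; rewrite quad_expand.
apply: (@le_trans _ _ ((\sum_i \sum_j `|Q i j|) * r ^+ 2)); last first.
  by rewrite ler_wpM2r ?exprn_ge0// lerDr.
rewrite big_distrl /=; apply: ler_sum => i _.
rewrite big_distrl /=; apply: ler_sum => j _.
apply: (le_trans (ler_norm _)); rewrite !normrM mulrAC -mulrA [leRHS]mulrC expr2.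
by rewrite mulrA ler_wpM2r// ler_pM.
Qed.

End quadratic_form.

(** * Lebesgue measure under linear isometries *)

Lemma integral_sections d1 d2 (T1 : measurableType d1) (T2 : measurableType d2)
    (R : realType) (m1 : {sigma_finite_measure set T1 -> \bar R})
    (m2 : {sigma_finite_measure set T2 -> \bar R}) (G : set (T1 * T2)) :
  measurable G ->
  (\int[m1]_x m2 (xsection G x) = \int[m2]_y m1 (ysection G y))%E.
Proof.
move=> mG; apply: (@product_measure_unique _ _ _ _ _ m1 m2
  (m1 \x^ m2 : {measure set _ -> \bar R})%E) => // A B mA mB.
exact: product_measure2E.
Qed.

Section lebesgue_linear.
Variables (R : realType) (n : nat).
Local Notation L := (lebesgue_cV R n).

(** The set [G] below has
    [y]-sections of measure [L A * \1_E y] and [H] has [y]-sections of measure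
    [L E * \1_ThA y], while their [x]-sections differ by the translation
    [y |-> y + invmx Th *m x]; so [L A * L E = L E * L ThA], and [L E]
    cancels. *)
Lemma lebesgue_cV_linear (Th : 'M[R]_n) (E : set 'cV[R]_n) :
  Th \in unitmx -> measurable E -> (0 < L E < +oo)%E ->
  (forall x, E (- x) <-> E x) -> (forall x, E (Th *m x) <-> E x) ->
  forall A, measurable A -> L ((fun x => Th *m x) @^-1` A) = L A.
Proof.
move=> Thu mE /andP[E0 Eoo] EN ETh A mA.
have mTh : measurable_fun setT (fun x : 'cV[R]_n => Th *m x).
  exact: measurable_cV_linear.
have mTh2 : measurable_fun setT (fun z : 'cV[R]_n * 'cV[R]_n => Th *m z.2).
  exact: measurable_cV_linear.
set ThA := _ @^-1` A.
have mThA : measurable ThA by exact: measurable_funT_preimage.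
pose G := [set z : 'cV[R]_n * 'cV[R]_n | A (z.1 + Th *m z.2) /\ E (Th *m z.2)].
pose H := [set z : 'cV[R]_n * 'cV[R]_n | A (Th *m z.2) /\ E (Th *m z.2 - z.1)].
have mG : measurable G.
  apply: measurableI; last exact: (measurable_funT_preimage mTh2 mE).
  apply: (measurable_funT_preimage _ mA).
  exact: measurable_cVD.
have mH : measurable H.
  apply: measurableI; first exact: (measurable_funT_preimage mTh2 mA).
  apply: (measurable_funT_preimage _ mE).
  apply: measurable_cVD => //.
  rewrite (_ : (fun _ => _) = (fun z => (- 1%:M) *m z.1)).
    exact: measurable_cV_linear.
  by apply/funext => z; rewrite mulNmx mul1mx.
have integral_weight k (B : set 'cV[R]_n) (f : 'cV[R]_n -> \bar R) :
    (0 <= k)%E -> measurable B -> (forall y, f y = k * (\1_B y)%:E)%E ->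
    (\int[L]_y f y = k * L B)%E.
  move=> k0 mB fE; under eq_integral do rewrite fE.
  by rewrite ge0_integralZl ?integral_indic ?setIT//; exact/measurable_EFinP.
have GE : (\int[L]_y L (ysection G y) = L A * L E)%E.
  apply: integral_weight => // y; rewrite indicE.
  case: (boolP (y \in E)) => /=; rewrite ?inE ?notin_setE => Ey.
    rewrite mule1 -[RHS](lebesgue_cV_translation (Th *m y) mA); congr (L _).
    apply/seteqP; split => x; rewrite /ysection /= inE /G /=; last by move=> Ax; split=> //; apply/ETh.
    by case.
  rewrite mule0 (_ : ysection _ _ = set0) ?measure0//.
  by apply/seteqP; split => x //; rewrite /ysection /= inE => -[_ /ETh].
have HE : (\int[L]_y L (ysection H y) = L E * L ThA)%E.
  apply: integral_weight => // y; rewrite indicE.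
  case: (boolP (y \in ThA)) => /=; rewrite ?inE ?notin_setE => Ay.
    rewrite mule1 -[RHS](lebesgue_cV_translation (- (Th *m y)) mE); congr (L _).
    apply/seteqP; split => x; rewrite /ysection /= inE /H /=.
      by move=> [_ /EN]; rewrite opprB.
    by move=> /EN; rewrite opprB.
  rewrite mule0 (_ : ysection _ _ = set0) ?measure0//.
  by apply/seteqP; split => x //; rewrite /ysection /= inE => -[].
have GH : (\int[L]_x L (xsection G x) = \int[L]_x L (xsection H x))%E.
  apply: eq_integral => x _.
  rewrite -(lebesgue_cV_translation (invmx Th *m x) (measurable_xsection x mH)).
  congr (L _); apply/seteqP; split => y; rewrite /xsection /= !inE /G /H /= mulmxDr mulKVmx// addrK (addrC x)//.
move: GH; rewrite !integral_sections// GE HE muleC => /esym.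
have Efin : L E \is a fin_num by rewrite ge0_fin_numE.
move: E0; rewrite -(fineK Efin) lte_fin => e0.
move=> /(congr1 (fun z => (fine (L E))^-1%:E * z)%E).
by rewrite !muleA -!EFinM mulVf ?gt_eqF// !mul1e.
Qed.

End lebesgue_linear.

Lemma measurable_quad (R : realType) n (Q : 'M[R]_n) :
  measurable_fun [set: 'cV[R]_n] (quad Q : 'cV[R]_n -> measurableTypeR R).
Proof.
rewrite (_ : quad Q = fun x => \sum_i \sum_j x i 0 * Q i j * x j 0); last first.
  by apply/funext => x; exact: quad_expand.
apply: measurable_sum => i; apply: measurable_sum => j.
apply: measurable_funM; last exact: measurable_cV_coord.
by apply: measurable_funM => //; exact: measurable_cV_coord.
Qed.

Section lebesgue_isometry.
Variables (R : realType) (n : nat).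
Local Notation L := (lebesgue_cV R n).

HB.instance Definition _ (F : 'M[R]_n) :=
  @isMeasurableFun.Build _ _ 'cV[R]_n 'cV[R]_n (mulmx F)
    (measurable_cV_linear F (@measurable_id _ 'cV[R]_n setT)).

Lemma lebesgue_cV_cube (r : R) : 0 < r ->
  L [set x | forall i, `[- r, r]%classic (x i 0)] = ((r + r) ^+ n)%:E.
Proof.
move=> r0; rewrite (@lebesgue_cV_box R n (fun=> `[- r, r]%classic))//; last first.
rewrite (eq_bigr (fun=> (r + r)%:E)).
  by rewrite prodEFin prodr_const card_ord.
move=> i _; rewrite lebesgue_measure_itv/= lte_fin ifT ?opprK -?EFinB ?opprK//.
by rewrite (lt_trans _ r0)// oppr_lt0.
Qed.

(** The unit ball of [Q] is invariant under [Th]; it lies between two cubes, so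
    that its measure is positive and finite. *)
Lemma lebesgue_cV_isometry (Q Th : 'M[R]_n) : posdef Q -> Th \in unitmx ->
  (forall x, quad Q (Th *m x) = quad Q x) ->
  forall A, measurable A -> L (mulmx Th @^-1` A) = L A.
Proof.
move=> Qpos Thu QTh; pose E := [set x : 'cV[R]_n | quad Q x <= 1].
have mE : measurable E.
  rewrite (_ : E = quad Q @^-1` `]-oo, 1]%classic).
    apply: measurable_funT_preimage; first exact: measurable_quad.
    exact: measurable_itv.
  by apply/seteqP; split=> x /=; rewrite in_itv.
have mcube (r : R) : measurable [set x : 'cV[R]_n | forall i, `[- r, r]%classic (x i 0)].
  have -> : [set x : 'cV[R]_n | forall i, `[- r, r]%classic (x i 0)] =
    \bigcap_(i in [set: 'I_n]) (cV_coord i @^-1` `[- r, r]%classic).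
    by apply/seteqP; split => x /= h i; [move=> _|]; apply: h.
  apply: fin_bigcap_measurable => // i _.
  apply: measurable_funT_preimage; first exact: measurable_cV_coord.
  exact: measurable_itv.
apply: (lebesgue_cV_linear Thu mE) => [|x|x]; last 2 first.
- by rewrite /E /= quadN.
- by rewrite /E /= QTh.
apply/andP; split.
  have [c c0 Qle] := quad_le Q.
  have r0 : 0 < (c + 1)^-1 by rewrite invr_gt0 ltr_wpDl// ltW.
  apply: (@lt_le_trans _ _ (((c + 1)^-1 + (c + 1)^-1) ^+ n)%:E).
    by rewrite lte_fin exprn_gt0// addr_gt0.
  rewrite -lebesgue_cV_cube//; apply: le_measure; [by apply: mem_set; apply: mcube|exact: mem_set|].
  move=> x /= xr; rewrite /E /=.
  have /le_trans : quad Q x <= c * (c + 1)^-1 ^+ 2.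
    apply: Qle; first exact: ltW.
    by move=> i; have := xr i; rewrite /= in_itv/= ler_norml.
  apply; rewrite exprVn ler_pdivrMr ?mul1r ?exprn_gt0// ?ltr_wpDl// 1?ltW//.
  by rewrite expr2; nra.
have [c c0 Qge] := quad_coord_bound Qpos.
have r0 : 0 < c + 1 by rewrite ltr_wpDl// ltW.
apply: (@le_lt_trans _ _ (((c + 1) + (c + 1)) ^+ n)%:E); last exact: ltry.
rewrite -lebesgue_cV_cube//; apply: le_measure; [exact: mem_set|by apply: mem_set; apply: mcube|].
move=> x /= Ex i; rewrite /= in_itv/= -ler_norml.
have := Qge x i; have : 0 <= `|x i 0| by [].
move: `|x i 0| Ex => a; rewrite /E /= => q1 a0 aq.
have : a ^+ 2 <= c by rewrite (le_trans aq)// ler_piMr// ltW.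
by rewrite expr2; nra.
Qed.

End lebesgue_isometry.

(** * Random vectors with symmetric densities *)

Lemma image_mulmx_mem (R : realType) m (F : 'M[R]_m) (S : set 'cV[R]_m) x :
  F \in unitmx -> [set F *m y | y in S] = S -> S (F *m x) <-> S x.
Proof.
move=> Fu FS; split; last by move=> Sx; rewrite -FS; exists x.
by rewrite -{1}FS => -[y Sy /(can_inj (mulKmx Fu)) <-].
Qed.

Section invariant_law.
Context d (T : measurableType d) (R : realType) (P : probability T R) (n : nat).
Variables (X : {RV P >-> 'cV[R]_n}) (Th : 'M[R]_n).
Hypothesis Thu : Th \in unitmx.

(** The density [f] is only assumed invariant on [D], which is enough because
    the law is carried by [D] and [Th] permutes [D]. *)
Lemma distribution_invariant (f : 'cV[R]_n -> R) (D : set 'cV[R]_n) :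
  has_density X f -> measurable D -> (forall w, D (X w)) ->
  [set Th *m e | e in D] = D -> (forall e, D e -> f (Th *m e) = f e) ->
  (forall A, measurable A -> lebesgue_cV R n (mulmx Th @^-1` A) = lebesgue_cV R n A) ->
  forall A, measurable A ->
    distribution P X (mulmx Th @^-1` A) = distribution P X A.
Proof.
move=> [mf f0 Xf] mD XD ThD fTh ThL A mA.
have D_Th x : D (Th *m x) <-> D x by exact: image_mulmx_mem.
have concentrated (B : set 'cV[R]_n) : distribution P X (B `&` D) = distribution P X B.
  rewrite /distribution /pushforward; congr (P _).
  by apply/seteqP; split=> w /= => [[]|].
rewrite -concentrated -[RHS]concentrated.
rewrite (_ : _ `&` D = mulmx Th @^-1` (A `&` D)); last first.
  by apply/seteqP; split=> x /= [? ?]; split=> //; apply/D_Th.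
have mAD : measurable (A `&` D) by exact: measurableI.
rewrite !Xf//; last exact: measurable_funT_preimage.
rewrite -[RHS](@integral_comp_preserving _ _ _ (lebesgue_cV R n)
  (mulmx Th) (mulmx (invmx Th)) (mulKmx Thu) (mulKVmx Thu) ThL).
apply: eq_integral => x; rewrite inE => -[_ /D_Th Dx].
by rewrite fTh.
Qed.

Hypothesis Th_law : forall A, measurable A ->
  distribution P X (mulmx Th @^-1` A) = distribution P X A.

Lemma integral_law_invariant (f : 'cV[R]_n -> \bar R) :
  (\int[distribution P X]_e f (Th *m e) = \int[distribution P X]_e f e)%E.
Proof.
exact: (@integral_comp_preserving _ _ _ (distribution P X)
  (mulmx Th) (mulmx (invmx Th)) (mulKmx Thu) (mulKVmx Thu) Th_law setT f).
Qed.

(** The mean is the coordinatewise integral of the identity under an invariant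
    law; boundedness of [D] makes the coordinates integrable, so that [Th] can be
    moved inside the integral. *)
Lemma mean_invariant (D : set 'cV[R]_n) : bounded_set D -> (forall w, D (X w)) ->
  Th *m mean X = mean X.
Proof.
move=> [b [_ Db]] XD.
have mX i : measurable_fun setT (fun w => X w i 0).
  by apply: (measurableT_comp (measurable_cV_coord i)).
have intX i : P.-integrable setT (EFin \o (fun w => X w i 0)).
  apply: measurable_bounded_integrable => //.
    by rewrite (le_lt_trans (probability_le1 P measurableT))// ltry.
  exists b; split; first exact: num_real.
  move=> c /Db bc w _ /=; apply: (le_trans _ (bc _ (XD w))).
  by rewrite [leRHS]/Num.Def.normr /= mx_normrE; apply/bigmax_geP; right; exists (i, 0).
have finX i : ('E_P[(fun w => X w i 0)%R])%E \is a fin_num.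
  by rewrite unlock; exact: (integrable_fin_num measurableT (intX i)).
apply/matrixP => i k; rewrite [k]ord1 !mxE; apply: EFin_inj.
rewrite -sumEFin fineK//.
transitivity (\sum_j (Th i j)%:E * 'E_P[(fun w => X w j 0)%R])%E.
  by apply: eq_bigr => j _; rewrite mxE EFinM fineK.
have intZX j : P.-integrable setT (fun w => (Th i j)%:E * (X w j 0)%:E)%E.
  by apply: integrableZl => //; exact: intX.
transitivity (\int[P]_w \sum_j ((Th i j)%:E * (X w j 0)%:E))%E.
  rewrite integral_sum//.
  by apply: eq_bigr => j _; rewrite unlock integralZl//; exact: intX.
have intTh : P.-integrable setT ((fun e : 'cV[R]_n => ((Th *m e) i 0)%:E) \o X).
  rewrite (_ : _ \o _ = (fun w => \sum_j (Th i j)%:E * (X w j 0)%:E)%E).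
    by apply: integrable_sum => // j _.
  by apply/funext => w /=; rewrite mxE -sumEFin.
transitivity (\int[distribution P X]_e ((Th *m e) i 0)%:E)%E.
  rewrite integral_distribution//.
    by apply: eq_integral => w _ /=; rewrite mxE -sumEFin.
  apply/measurable_EFinP.
  apply: (measurableT_comp (measurable_cV_coord i)).
  exact: measurable_cV_linear.
rewrite (integral_law_invariant (fun e => (e i 0)%:E)).
rewrite integral_distribution; [by rewrite unlock| |exact: intX].
by apply/measurable_EFinP; exact: measurable_cV_coord.
Qed.

End invariant_law.

(** * Symmetries of the dynamic programs *)

Section symmetric_dynamic_program.
Variables (R : realType) (n p : nat) (M : mpc R n p).
Variables (Th : 'M[R]_n) (Om : 'M[R]_p).
Hypothesis aut : mpc_aut M (Th, Om).

Lemma feasible_aut t x u : (t < horizon M)%N ->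
  feasible M t (Th *m x) (Om *m u) <-> feasible M t x u.
Proof.
case: aut => -[Thu Omu ThA ThB] [_ ThX OmU ThD _] tN.
have succE e : dynA M *m (Th *m x) + dynB M *m (Om *m u) + Th *m e =
    Th *m (dynA M *m x + dynB M *m u + e).
  by rewrite !mulmxA -ThA -ThB -!mulmxA -!mulmxDr.
split=> -[Uu Xu]; split.
- exact/(image_mulmx_mem u Omu OmU).
- move=> e De; apply/(image_mulmx_mem _ Thu (ThX _ tN)); rewrite -succE.
  by apply: Xu; apply/(image_mulmx_mem _ Thu (ThD _ tN)).
- exact/(image_mulmx_mem u Omu OmU).
- move=> e; rewrite -[e](mulKVmx Thu) succE.
  move=> /(image_mulmx_mem _ Thu (ThD _ tN)) De.
  by apply/(image_mulmx_mem _ Thu (ThX _ tN)); exact: Xu.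
Qed.

(** [next] stands for either averaging operator; commuting with [Th] on invariant
    cost-to-go functions is all that the recursion uses. *)
Variable next : nat -> ('cV[R]_n -> \bar R) -> 'cV[R]_n -> \bar R.
Hypothesis next_aut : forall t V z, (t < horizon M)%N ->
  (forall x, V (Th *m x) = V x) -> next t V (Th *m z) = next t V z.

Lemma bellman_objective_aut t V x u : (t < horizon M)%N ->
  (forall y, V (Th *m y) = V y) ->
  bellman_objective M next t V (Th *m x) (Om *m u) =
  bellman_objective M next t V x u.
Proof.
case: aut => -[Thu Omu ThA ThB] [ThC _ _ _ _] tN VTh.
rewrite /bellman_objective ThC ?(ltnW tN)//; congr (_ + _)%E.
by rewrite !mulmxA -ThA -ThB -!mulmxA -mulmxDr next_aut.
Qed.

(** Invariance holds at every point, also outside the state constraints, where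
    the recursion is given by the same formula.  In the inductive step,
    [u |-> Om *m u] is a bijection between the inputs feasible at [x] and at
    [Th *m x]. *)
Lemma value_togo_aut k x : (k <= horizon M)%N ->
  value_togo M next k (Th *m x) = value_togo M next k x.
Proof.
case: (aut) => -[Thu Omu _ _] [ThC _ _ _ _].
elim: k x => [|k IH] x kN /=.
  by rewrite -[in LHS](mulmx0 1 Om) ThC.
have tN : (horizon M - k.+1 < horizon M)%N by rewrite ltn_subrL/= (leq_trans _ kN).
have VTh y := IH y (ltnW kN).
congr ereal_inf; apply/seteqP; split=> _ [u uf <-].
  exists (invmx Om *m u).
    by apply/feasible_aut => //; rewrite mulKVmx.
  by rewrite -bellman_objective_aut// mulKVmx.
exists (Om *m u); first exact/feasible_aut.
by rewrite bellman_objective_aut.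
Qed.

Lemma value_aut t x : value M next t (Th *m x) = value M next t x.
Proof. by rewrite /value value_togo_aut// leq_subr. Qed.

Lemma domain_aut t x : (t <= horizon M)%N ->
  domain M next t (Th *m x) <-> domain M next t x.
Proof.
case: aut => -[Thu _ _ _] [_ ThX _ _ _] tN.
rewrite /domain /= value_aut.
by split=> -[xX ?]; split=> //; apply/(image_mulmx_mem x Thu (ThX _ tN)).
Qed.

Lemma minimizer_aut t x u : (t < horizon M)%N ->
  minimizer M next t (Th *m x) (Om *m u) <-> minimizer M next t x u.
Proof.
move=> tN; rewrite /minimizer /objective value_aut bellman_objective_aut//.
  by split=> -[? ->]; split=> //; apply/feasible_aut.
exact: value_aut.
Qed.

(** Minimizers at [x] and at [Th *m x] correspond under [Om].  Where no unique
    minimizer exists, both optimizers take the default value [0], which the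
    linear map [Om] fixes. *)
Lemma optimizer_aut t x : (t < horizon M)%N ->
  optimizer M next t (Th *m x) = Om *m optimizer M next t x.
Proof.
move=> tN; case: (aut) => -[_ Omu _ _] _; rewrite /optimizer.
set S := [set u | minimizer M next t x u /\ _].
set S' := [set u | minimizer M next t (Th *m x) u /\ _].
have S'E u : S' (Om *m u) <-> S u.
  split=> -[umin uuniq]; split.
  - exact/minimizer_aut.
  - move=> v vmin; apply: (can_inj (mulKmx Omu)); apply: uuniq.
    exact/minimizer_aut.
  - exact/minimizer_aut.
  - move=> v; rewrite -[v](mulKVmx Omu) => /minimizer_aut-/(_ tN)/uuniq.
    by move=> ->.
have [[u Su]|noS] := pselect (exists u, S u).
  have -> : xget 0 S = u by apply: xget_unique => // v [/(Su.2)].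
  apply: xget_unique; first exact/S'E.
  by move=> v [/((S'E u).2 Su).2].
rewrite !xgetPN ?mulmx0// => u Su; first by apply: noS; exists u.
by apply: noS; exists (invmx Om *m u); apply/S'E; rewrite mulKVmx.
Qed.

End symmetric_dynamic_program.

(** * Symmetries of the disturbance averages *)

Section symmetric_disturbance.
Context d (T : measurableType d) (R : realType) (P : probability T R).
Variables (n p : nat) (M : mpc R n p) (dist : nat -> {RV P >-> 'cV[R]_n}).
Hypothesis HM : mpc_assumptions M dist.

Variables (Th : 'M[R]_n) (Om : 'M[R]_p).
Hypothesis aut : mpc_aut M (Th, Om).

(** The terminal cost is a function of the state alone, so its invariance makes
    [Th] an isometry for a single positive definite form. *)
Lemma quad_terminal_aut x :
  quad (costQ M (horizon M)) (Th *m x) = quad (costQ M (horizon M)) x.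
Proof.
case: aut => _ [ThC _ _ _ _].
by have := ThC _ (leqnn _) x 0; rewrite /cost ltnn.
Qed.

Lemma disturbance_law_aut t : (t < horizon M)%N -> forall A, measurable A ->
  distribution P (dist t) (mulmx Th @^-1` A) = distribution P (dist t) A.
Proof.
move=> tN; case: (aut) => -[Thu _ _ _] [_ _ _ ThD Thp].
apply: (distribution_invariant (D := distset M t) Thu (dist_density HM t)).
- by apply: measurable_polyhedron; have [] := distset_polytope HM t.
- exact: dist_in_distset HM t.
- exact: ThD.
- exact: Thp.
apply: (lebesgue_cV_isometry _ Thu quad_terminal_aut).
exact: (costQ_posdef HM (leqnn _)).
Qed.

Lemma exact_next_aut t V z : (t < horizon M)%N ->
  (forall x, V (Th *m x) = V x) ->
  exact_next dist t V (Th *m z) = exact_next dist t V z.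
Proof.
move=> tN VTh; case: (aut) => -[Thu _ _ _] _; rewrite /exact_next.
rewrite -(integral_law_invariant Thu (disturbance_law_aut tN)).
by apply: eq_integral => e _; rewrite -mulmxDr VTh.
Qed.

Lemma ce_next_aut t V z : (t < horizon M)%N ->
  (forall x, V (Th *m x) = V x) ->
  ce_next dist t V (Th *m z) = ce_next dist t V z.
Proof.
move=> tN VTh; case: (aut) => -[Thu _ _ _] _; rewrite /ce_next.
rewrite -{1}(mean_invariant Thu (disturbance_law_aut tN) (distset_polytope HM t).2).
  by rewrite -mulmxDr VTh.
exact: dist_in_distset HM t.
Qed.

End symmetric_disturbance.

Theorem theorem2 (disp : measure_display) (T : measurableType disp)
    (R : realType) (P : probability T R) (n p : nat) (M : mpc R n p)
    (dist : nat -> {RV P >-> 'cV[R]_n}) (t : nat)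
    (Rs : set (set 'cV[R]_n)) (Ri : set 'cV[R]_n) :
  mpc_assumptions M dist ->
  (t < horizon M)%N ->
  critical_regions (domain M (ce_next dist) t) (ce_policy M dist t) Rs ->
  Rs Ri ->
  certainty_equivalence_on M dist t Ri ->
  forall Rj, region_orbit M Ri Rj -> certainty_equivalence_on M dist t Rj.
Proof.
move=> HM tN _ _ ceRi _ [[Th Om] aut <-] _ [x Rix <-] /=.
have [xex xce xeq] := ceRi x Rix.
have exact_inv := exact_next_aut HM aut.
have ce_inv := ce_next_aut HM aut.
split.
- by apply/(domain_aut aut exact_inv); first exact: ltnW.
- by apply/(domain_aut aut ce_inv); first exact: ltnW.
rewrite /exact_policy /ce_policy (optimizer_aut aut exact_inv)//.
by rewrite (optimizer_aut aut ce_inv)//; congr (_ *m _).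
Qed.
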